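(* Let $X$ and $H$ be any two graphs and let $S=K[V(X\odot H)]$. Then $$\dim(S/I(X\odot H))=|V(X)|\cdot\big(\dim(K[V(H)]/I(H))+|i(H)|\big),$$ where $\dim$ denotes Krull dimension.
   Context: $K$ is a field. All graphs are finite, simple, have nonempty vertex set, and may have isolated vertices. Vertices of a graph $G$ are identified with the variables of the polynomial ring $K[V(G)]$. $i(H)$ denotes the set of isolated vertices of $H$. Edge ideal convention: $I(G)\subset K[V(G)]$ is the ideal generated by all products $x_ix_j$ with $\{x_i,x_j\}\in E(G)$ together with all variables $x_k$ with $x_k$ an isolated vertex of $G$. Thus $K[V(H)]/I(H)\cong K[V(H')]/I(H')$, where $H'$ is the induced subgraph of $H$ on the non-isolated vertices, and if $H$ has no edges then $K[V(H)]/I(H)\cong K$ has dimension $0$. The corona product $X\odot H$ is the graph obtained from one copy of $X$ and $|V(X)|$ disjoint copies of $H$, namely $H_1,\dots,H_{|V(X)|}$, by joining the $i$-th vertex of $X$ to every vertex of $H_i$. It has no isolated vertices, so $I(X\odot H)$ is the usual edge ideal. *)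

(* Defs.v *)
From HB Require Import structures.
From mathcomp Require Import all_boot all_order all_algebra.
From mathcomp Require Import ring_quotient boolp mpoly.

Set Implicit Arguments.
Unset Strict Implicit.
Unset Printing Implicit Defensive.
Import GRing.Theory.
Local Open Scope ring_scope.

Record sgraph := SGraph {
  vertex :> finType;
  adj : rel vertex;
  adj_sym : ssrbool.symmetric adj; (* mpoly shadows [symmetric] *)
  adj_irr : irreflexive adj;
  vertex_gt0 : (0 < #|vertex|)%N
}.

Definition isolated (G : sgraph) : {set G} :=
  [set v | [forall w, ~~ adj v w]].

Section Corona.
Variables X H : sgraph.

(* [inl x] is the vertex x of X; [inr (x, h)] is the copy of h in the copy of
   H attached to x. *)
Definition corona_adj : rel (X + X * H)%type := fun u v =>
  match u, v with
  | inl x, inl y => adj x y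
  | inl x, inr (y, _) => x == y
  | inr (x, _), inl y => x == y
  | inr (x, h), inr (y, k) => (x == y) && adj h k
  end.

Lemma corona_adj_sym : ssrbool.symmetric corona_adj.
Proof.
by case=> [x|[x h]] [y|[y k]] //=; rewrite 1?eq_sym // adj_sym.
Qed.

Lemma corona_adj_irr : irreflexive corona_adj.
Proof. by case=> [x|[x h]] /=; rewrite adj_irr ?andbF. Qed.

Lemma corona_vertex_gt0 : (0 < #|{: X + X * H}|)%N.
Proof. by rewrite card_sum addn_gt0 vertex_gt0. Qed.

Definition corona : sgraph :=
  SGraph corona_adj_sym corona_adj_irr corona_vertex_gt0.

End Corona.

Lemma isolated_corona (X H : sgraph) : isolated (corona X H) = set0.
Proof.
have /card_gt0P[h _] := vertex_gt0 H.
apply/setP=> -[x|[x k]]; rewrite !inE; apply/negP=> /forallP.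
  by move/(_ (inr (x, h))); rewrite /= eqxx.
by move/(_ (inl x)); rewrite /= eqxx.
Qed.

Definition ideal_gen (R : comNzRingType) (B : R -> Prop) : {pred R} :=
  fun p => `[< exists s : seq (R * R),
    (forall c, c \in s -> B c.2) /\ p = \sum_(c <- s) c.1 * c.2 >].

Lemma ideal_genP (R : comNzRingType) (B : R -> Prop) p :
  reflect (exists s : seq (R * R),
    (forall c, c \in s -> B c.2) /\ p = \sum_(c <- s) c.1 * c.2)
    (p \in ideal_gen B).
Proof. exact: asboolP. Qed.

Lemma ideal_gen_closed (R : comNzRingType) (B : R -> Prop) :
  1 \notin ideal_gen B -> idealr_closed (ideal_gen B).
Proof.
move=> B1; split=> //.
  by apply/ideal_genP; exists [::]; rewrite big_nil.
move=> a u v /ideal_genP[s [Bs ->]] /ideal_genP[t [Bt ->]].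
apply/ideal_genP; exists ([seq (a * c.1, c.2) | c <- s] ++ t); split.
  by move=> c; rewrite mem_cat => /orP[/mapP[e /Bs ? ->]|/Bt].
rewrite big_cat big_map mulr_sumr /=; congr (_ + _).
by apply: eq_bigr => c _; rewrite mulrA.
Qed.

Section EdgeIdeal.
Variables (K : fieldType) (G : sgraph).

(* K[V(G)] is {mpoly K[#|G|]}, the vertices being numbered by [enum_rank]. *)
Definition vvar (v : G) : {mpoly K[#|G|]} := 'X_(enum_rank v).

Definition edge_gen (p : {mpoly K[#|G|]}) : Prop :=
  (exists u v : G, adj u v /\ p = vvar u * vvar v) \/
  (exists2 v : G, v \in isolated G & p = vvar v).

Definition edge_ideal : {pred {mpoly K[#|G|]}} := ideal_gen edge_gen.

Lemma edge_ideal_closed : idealr_closed edge_ideal.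
Proof.
apply: ideal_gen_closed; apply/negP=> /ideal_genP[s [Bs]].
move/(congr1 (mcoeff 0%MM))/eqP; rewrite mcoeff1 eqxx raddf_sum /=.
rewrite big_seq big1 ?oner_eq0 // => c /Bs.
have E v : (vvar v)@_0%MM = 0 by rewrite mcoeffX mnm1_eq0.
have M0 (p q : {mpoly K[#|G|]}) : (p * q)@_0%MM = p@_0%MM * q@_0%MM.
  exact: rmorphM.
by case=> [[u [v [_ ->]]]|[v _ ->]]; rewrite !M0 !E !mulr0.
Qed.

HB.instance Definition _ := isIdealr.Build _ edge_ideal edge_ideal_closed.

Definition edge_ring : comNzRingType := {ideal_quot edge_ideal}.

End EdgeIdeal.

Section KrullDim.
Variable A : comNzRingType.

Definition prime_ideal (P : {pred A}) : Prop :=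
  idealr_closed P /\ prime_idealr_closed P.

(* P 0 < P 1 < ... < P n *)
Definition prime_chain (n : nat) (P : nat -> {pred A}) : Prop :=
  (forall i, (i <= n)%N -> prime_ideal (P i)) /\
  (forall i, (i < n)%N ->
    {subset P i <= P i.+1} /\ exists2 a, a \in P i.+1 & a \notin P i).

Definition is_krull_dim (d : nat) : Prop :=
  (exists P, prime_chain d P) /\
  (forall n P, prime_chain n P -> (n <= d)%N).

(* [None] stands for infinite dimension. *)
Definition krull_dim : option nat :=
  if pselect (exists d, is_krull_dim d) is left h
  then Some (projT1 (cid h)) else None.

Lemma krull_dimP d : krull_dim = Some d <-> is_krull_dim d.
Proof.
rewrite /krull_dim; case: pselect => [h|nh]; last first.
  by split=> // hd; case: nh; exists d.
case: (cid h) => e He /=; split=> [[<-] //|Hd]; congr Some.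
case: He Hd => -[P cP] He [[Q cQ] Hd].
by apply/eqP; rewrite eqn_leq (Hd _ _ cP) (He _ _ cQ).
Qed.

End KrullDim.

(* Main.v *)
Require Import Defs.
From mathcomp Require Import all_boot all_order all_algebra.
From mathcomp Require Import ring_quotient boolp mpoly zify.

(** Write alpha(G) for the largest size of an independent set of G, and call a
    set of vertices a face when it is independent and contains no isolated
    vertex.  The theorem follows from two facts.

    The Krull dimension of K[V(G)]/I(G) is the largest size of a face
    ([krull_dim_edge_ring]).  For the lower bound, let A be a face: the ideal
    generated by the variables outside A is prime and contains I(G), and adding
    the variables of A to its generators one at a time gives a chain of #|A|
    strict inclusions.  For the upper bound, take a chain P_0 < ... < P_k of
    primes of K[V(G)] containing I(G).  Since P_0 is prime and contains the
    generators of I(G), the vertices whose variable is not in P_0 form a face S,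
    and it remains to see that k <= #|S| ([prime_chain_mpoly_le]).

    This last inequality is the bound dim K[S] <= #|S|, obtained as in the
    elementary characterisation of Krull dimension by Coquand and Lombardi.  If
    x_i is in P_(i+1) but not in P_i, then x_0, ..., x_(k-1) are algebraically
    independent modulo P_0 ([chain_alg_indep]).  On the other hand, if k > #|S|,
    there are too many monomials of bounded degree in the x_i, compared with the
    monomials in the variables of S, for these x_i to be algebraically
    independent modulo P_0 ([algebraic_dependence]).

    The rest is combinatorics.  Adding all the isolated vertices to a face keeps
    it independent, so alpha(G) is the dimension plus the number of isolated
    vertices ([independence_number_face]).  In the corona, an independent set
    meets the part lying over a vertex x of X (x and its copy of H) either in x
    alone or in an independent set of the copy of H, so alpha of the corona is
    #|X| * alpha(H) ([independence_number_corona]); and the corona has no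
    isolated vertex. *)

Set Implicit Arguments.
Unset Strict Implicit.
Unset Printing Implicit Defensive.
Import GRing.Theory.
Local Open Scope ring_scope.
Local Open Scope quotient_scope.

(** * Prime ideals and chains of prime ideals *)

Section PrimeIdealTheory.
Variables (A : comNzRingType) (P : {pred A}).
Hypothesis primeP : prime_ideal P.

Lemma prime_ideal0 : 0 \in P.
Proof. by case: primeP => -[]. Qed.

Lemma prime_ideal1 : 1 \notin P.
Proof. by case: primeP => -[]. Qed.

Lemma prime_ideal_lin a u v : u \in P -> v \in P -> a * u + v \in P.
Proof. by case: primeP => -[_ _ lin] _; apply: lin. Qed.

Lemma prime_idealMl a u : u \in P -> a * u \in P.
Proof. by move=> Pu; rewrite -[_ * _]addr0 prime_ideal_lin ?prime_ideal0. Qed.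

Lemma prime_idealMr a u : u \in P -> u * a \in P.
Proof. by rewrite mulrC; apply: prime_idealMl. Qed.

Lemma prime_idealD u v : u \in P -> v \in P -> u + v \in P.
Proof. by rewrite -{2}[u]mul1r; apply: prime_ideal_lin. Qed.

Lemma prime_idealB u v : u \in P -> v \in P -> u - v \in P.
Proof. by move=> Pu Pv; rewrite addrC -mulN1r prime_ideal_lin. Qed.

Lemma prime_ideal_sum (I : eqType) (r : seq I) (F : I -> A) :
  (forall i, i \in r -> F i \in P) -> \sum_(i <- r) F i \in P.
Proof.
move=> PF; rewrite big_seq.
exact: (big_ind (fun u => u \in P) prime_ideal0 prime_idealD).
Qed.

Lemma prime_idealM u v : u * v \in P -> (u \in P) || (v \in P).
Proof. by case: primeP => _; apply. Qed.

End PrimeIdealTheory.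

Lemma prime_chain_behead (A : comNzRingType) n (P : nat -> {pred A}) :
  prime_chain n.+1 P -> prime_chain n (fun i => P i.+1).
Proof. by case=> Pp Ps; split=> i lin; [apply: Pp | apply: Ps]. Qed.

(** * Elements taken along a chain of primes are algebraically independent *)

(** The lowest coefficient of an expansion in powers of x that vanishes modulo P
    is congruent to a multiple of x modulo P, hence lies in Q, hence is zero; the
    remaining expression is a multiple of x, and x can be cancelled modulo P. *)
Lemma prime_expansion_coef0 (A : comNzRingType) (P Q : {pred A}) (x : A) N
    (g : 'I_N -> A) :
    prime_ideal P -> prime_ideal Q -> {subset P <= Q} ->
    x \in Q -> x \notin P ->
    (forall j, g j \in Q -> g j = 0) ->
    \sum_(j < N) x ^+ j * g j \in P ->
  forall j, g j = 0.
Proof.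
move=> primeP primeQ sPQ Qx Px; elim: N g => [|N IH] g g0; first by move=> _ [].
rewrite big_ord_recl /= mul1r.
under eq_bigr => j _ do rewrite /= /bump /= add1n exprS -mulrA.
rewrite -mulr_sumr => sumP.
have g00: g ord0 = 0.
  apply: g0; rewrite -[g _](addrK (x * \sum_(j < N) x ^+ j * g (lift ord0 j))).
  by apply: prime_idealB => //; [apply: sPQ | apply: prime_idealMr].
move: sumP; rewrite g00 add0r => /(prime_idealM primeP).
rewrite (negPf Px) => /= sumP j.
have [k ->|->] := unliftP ord0 j; last by [].
by apply: (IH (fun j => g (lift ord0 j))) => // i; apply: g0.
Qed.

Section Monomials.
Variable N : nat.

(** The exponent vectors of length k with entries below N, as an iterated product
    rather than as functions on 'I_k: the induction along a chain of primes
    singles out the first exponent, and sums over a product split into double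
    sums. *)
Fixpoint exponent (k : nat) : finType :=
  if k is k'.+1 then ('I_N * exponent k')%type else unit.

Lemma card_exponent k : #|exponent k| = (N ^ k)%N.
Proof.
elim: k => [|k IH]; first exact: card_unit.
by rewrite [LHS]card_prod IH card_ord expnS.
Qed.

Fixpoint monomial (A : comNzRingType) (k : nat) (x : nat -> A) :
    exponent k -> A :=
  match k return exponent k -> A with
  | 0 => fun=> 1
  | k'.+1 => fun e => x 0%N ^+ e.1 * monomial (fun i => x i.+1) e.2
  end.

End Monomials.

(** Algebraic independence modulo P 0, for polynomials of degree less than N in
    each variable.  Grouping the terms by the exponent of x 0 gives an expansion
    in powers of x 0 whose coefficients are polynomials in x 1, ..., x k; by
    induction along the tail of the chain these vanish as soon as they lie in
    P 1, which is the situation of [prime_expansion_coef0]. *)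
Lemma chain_alg_indep (K : fieldType) (A : comAlgType K) N k
    (P : nat -> {pred A}) (x : nat -> A) (c : exponent N k -> K) :
    prime_chain k P ->
    (forall i, (i < k)%N -> x i \in P i.+1 /\ x i \notin P i) ->
    \sum_e c e *: monomial x e \in P 0%N ->
  forall e, c e = 0.
Proof.
elim: k P x c => [|k IH] P x c chP xP.
  have primeP := chP.1 0%N isT.
  rewrite (eq_bigl (pred1 tt)); last by case.
  rewrite big_pred1_eq /= => cP [].
  have [//|c_neq0] := eqVneq (c tt) 0; case/negP: (prime_ideal1 primeP).
  by rewrite -[1](scalerK c_neq0) -mulr_algl prime_idealMl.
have primeP i : (i <= k.+1)%N -> prime_ideal (P i) by exact: chP.1.
have [sP01 _] := chP.2 0%N isT; have [x0P1 x0P0] := xP 0%N isT.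
pose g (i : 'I_N) := \sum_(e : exponent N k)
  c (i, e) *: monomial (fun i => x i.+1) e.
have gP i : g i \in P 1%N -> forall e, c (i, e) = 0.
  apply: (IH (fun i => P i.+1)); first exact: prime_chain_behead.
  by move=> j ltjk; apply: xP.
have -> : \sum_e c e *: monomial x e = \sum_(i < N) x 0%N ^+ i * g i.
  rewrite [RHS](eq_bigr _ (fun i _ => mulr_sumr _ _ _ _)) pair_big /=.
  by apply: eq_bigr => -[i e] _; rewrite scalerAr.
have primeP0 := primeP 0%N isT; have primeP1 := primeP 1%N isT.
move=> /(prime_expansion_coef0 primeP0 primeP1 sP01 x0P1 x0P0) g0 [i e].
apply: (gP); rewrite g0 => [|{e}i /gP ci0]; first exact: prime_ideal0.
by rewrite /g big1 // => e _; rewrite ci0 scale0r.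
Qed.

(** * Too many polynomials are algebraically dependent *)

Section DegreeCount.
Variables (K : fieldType) (n : nat).
Implicit Types p q : {mpoly K[n]}.

Lemma msizeM_bound p q a b :
  (msize p <= a.+1)%N -> (msize q <= b.+1)%N -> (msize (p * q) <= (a + b).+1)%N.
Proof.
have [->|p0] := eqVneq p 0; first by rewrite mul0r msize0.
have [->|q0] := eqVneq q 0; first by rewrite mulr0 msize0.
by rewrite msizeM //; move: (msize p) (msize q) => s t; lia.
Qed.

Lemma msizeX_bound p a i :
  (msize p <= a.+1)%N -> (msize (p ^+ i) <= (i * a).+1)%N.
Proof.
move=> pa; elim: i => [|i IH]; first by rewrite msize1.
by rewrite exprS mulSn msizeM_bound.
Qed.

Lemma msize_monomial N k D (x : nat -> {mpoly K[n]}) (e : exponent N k) :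
  (forall i, (i < k)%N -> msize (x i) <= D.+1)%N ->
  (msize (monomial x e) <= (k * (N * D)).+1)%N.
Proof.
elim: k x e => [|k IH] x e xD; first by rewrite msize1.
case: e => i e; rewrite mulSn msizeM_bound //; last first.
  by apply: IH => j ltjk; apply: xD.
apply: leq_trans (msizeX_bound i (xD 0%N isT)) _.
by rewrite ltnS leq_mul2r ltnW ?orbT /=.
Qed.

Definition supported (S : {set 'I_n}) (m : 'X_{1.. n}) : Prop :=
  forall i, i \notin S -> m i = 0%N.

(** The dependence modulo the ideal generated by the variables outside S: only
    the coefficients of the monomials supported in S are required to vanish.
    There are N ^ k monomials in the x i with exponents below N; if D bounds the
    degrees of the x i, theirs are at most k * N * D, and so at most
    (k * N * D + 1) ^ #|S| linear conditions are imposed.  As k > #|S|, the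
    unknowns outnumber the conditions once N is large. *)
Lemma algebraic_dependence (S : {set 'I_n}) k (x : nat -> {mpoly K[n]}) :
    (#|S| < k)%N ->
  exists N (c : exponent N k -> K), (exists e, c e != 0) /\
    forall m, supported S m -> (\sum_e c e *: monomial x e)@_m = 0.
Proof.
move=> ltSk; pose D := (\max_(i < k) msize (x i))%N.
have xD i : (i < k)%N -> (msize (x i) <= D.+1)%N.
  move=> ltik; apply: leqW.
  exact: (leq_bigmax (F := fun i : 'I_k => msize (x i)) (Ordinal ltik)).
(* The bound on degrees satisfies b <= (k * D + 1) * N, so this N, chosen
   larger than (k * D + 1) ^ #|S|, gives b ^ #|S| < N ^ (#|S| + 1). *)
pose N := ((k * D).+1 ^ #|S|).+1; pose b := (k * (N * D)).+1.
have ltbN : (b ^ #|S| < N ^ k)%N.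
  apply: leq_trans (_ : N ^ #|S|.+1 <= _)%N; last exact: leq_pexp2l.
  rewrite expnS; apply: leq_ltn_trans (_ : ((k * D).+1 * N) ^ #|S| < _)%N.
    have [->//|S_gt0] := posnP #|S|; rewrite leq_exp2r // /b; nia.
  by rewrite expnMn ltn_pmul2r ?expn_gt0.
pose T := {i | i \in S}; pose F := {ffun T -> 'I_b}.
pose mon (f : F) : 'X_{1.. n} :=
  [multinom oapp (fun j => f j : nat) 0%N (insub i : option T) | i < n].
pose M : 'M[K]_(#|exponent N k|, #|F|) :=
  \matrix_(i, j) (monomial x (enum_val i))@_(mon (enum_val j)).
(* A combination of the rows of M that vanishes is the relation sought. *)
have kerM : kermx M != 0.
  rewrite -mxrank_eq0 mxrank_ker subn_eq0 -ltnNge.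
  apply: leq_ltn_trans (rank_leq_col M) _.
  by rewrite card_ffun card_sig card_ord card_exponent.
pose v := nz_row (kermx M).
have vM : v *m M = 0 by apply/sub_kermxP/nz_row_sub.
exists N, (fun e => v 0 (enum_rank e)); split.
  have /rV0Pn[i vi] : v != 0 by rewrite nz_row_eq0.
  by exists (enum_val i); rewrite enum_valK.
move=> m Sm; have [ltmb|lebm] := ltnP (mdeg m) b; last first.
  rewrite raddf_sum big1 // => e _ /=; rewrite mcoeffZ memN_msupp_eq0 ?mulr0 //.
  by apply: msize_mdeg_ge; apply: leq_trans lebm; apply: msize_monomial.
pose f : F := [ffun j => inord (m (val j))].
have -> : m = mon f.
  apply/mnmP => i; rewrite mnmE; case: insubP => [j _ <-|/Sm //] /=.
  rewrite ffunE inordK //; apply: leq_ltn_trans ltmb.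
  by rewrite mdegE (bigD1 (val j)) //= leq_addr.
move/matrixP/(_ 0 (enum_rank f)): vM; rewrite !mxE => <-.
rewrite raddf_sum [RHS](reindex enum_rank) /=; last exact/onW_bij/enum_rank_bij.
by apply: eq_bigr => e _; rewrite mcoeffZ !mxE !enum_rankK.
Qed.

End DegreeCount.

(** Every monomial that is not supported on the variables outside P is a multiple
    of a variable in P. *)
Lemma prime_of_coeff (K : fieldType) n (P : {pred {mpoly K[n]}}) p :
    prime_ideal P ->
    (forall m, supported [set i | 'X_i \notin P] m -> p@_m = 0) ->
  p \in P.
Proof.
move=> primeP p0; rewrite (mpolyE p); apply: prime_ideal_sum => // m pm.
have [i Pi mi] : exists2 i, 'X_i \in P & m i != 0%N.
  apply: contrapT => nm; move: pm; rewrite mcoeff_msupp p0 ?eqxx // => i.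
  rewrite inE negbK => Pi; apply/eqP/negPn/negP => mi.
  by apply: nm; exists i.
have -> : 'X_[m] = 'X_[(m - U_(i))] * 'X_i :> {mpoly K[n]}.
  by rewrite -mpolyXD submK ?lep1mP.
by rewrite -mul_mpolyC mulrA prime_idealMl.
Qed.

Lemma prime_chain_mpoly_le (K : fieldType) n k
    (P : nat -> {pred {mpoly K[n]}}) :
  prime_chain k P -> (k <= #|[set i | 'X_i \notin P 0%N]|)%N.
Proof.
move=> chP; rewrite leqNgt; apply/negP => ltSk.
have /choice[x xP] i : exists a,
    (i < k)%N -> a \in P i.+1 /\ a \notin P i.
  case: (ltnP i k) => [ltik|_]; last by exists 0.
  by have [_ [a]] := chP.2 i ltik; exists a.
have [N [c [[e ce0] cS]]] := algebraic_dependence x ltSk.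
case/eqP: ce0; apply: (chain_alg_indep chP xP).
by apply: prime_of_coeff => //; exact: chP.1.
Qed.

(** * Primes generated by variables *)

Section MonomialPrimes.
Variables (K : fieldType) (n : nat).
Implicit Types (W : {set 'I_n}) (p : {mpoly K[n]}).

Definition kill_vars W : n.-tuple {mpoly K[n]} :=
  [tuple if i \in W then 0 else 'X_i | i < n].

(** The ideal generated by the variables in W, defined as the kernel of the
    substitution that kills them: primality is then inherited from the integral
    domain in which this substitution takes its values. *)
Definition var_prime W : {pred {mpoly K[n]}} :=
  [pred p | p \mPo kill_vars W == 0].

Lemma kill_varsX W i : 'X_i \mPo kill_vars W = if i \in W then 0 else 'X_i.
Proof. by rewrite comp_mpolyXU -tnth_nth tnth_mktuple. Qed.

Lemma var_primeP W : prime_ideal (var_prime W).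
Proof.
split; first split.
- by rewrite inE comp_mpoly0.
- by rewrite inE comp_mpoly1 oner_eq0.
- move=> a u v; rewrite !inE => /eqP u0 /eqP v0.
  by rewrite rmorphD rmorphM /= u0 v0 mulr0 addr0.
by move=> u v; rewrite !inE rmorphM mulf_eq0.
Qed.

Lemma var_prime_X W i : ('X_i \in var_prime W) = (i \in W).
Proof.
rewrite inE kill_varsX; case: (i \in W); rewrite ?eqxx //.
apply/negbTE/eqP => /(congr1 (mcoeff U_(i)))/eqP.
by rewrite mcoeffXU eqxx mcoeff0 oner_eq0.
Qed.

Lemma var_prime_sub W W' : W \subset W' -> {subset var_prime W <= var_prime W'}.
Proof.
move=> /subsetP sWW' p; rewrite !inE => /eqP pW.
suff -> : p \mPo kill_vars W' = (p \mPo kill_vars W) \mPo kill_vars W'.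
  by rewrite pW comp_mpoly0.
rewrite [p \mPo kill_vars W]comp_mpolyE raddf_sum comp_mpolyE.
apply: eq_bigr => m _ /=.
rewrite comp_mpolyZ rmorph_prod; congr (_ *: _); apply: eq_bigr => i _.
rewrite rmorphXn /= !tnth_mktuple; congr (_ ^+ _).
have [/sWW' ->|_] := boolP (i \in W); first by rewrite comp_mpoly0.
by rewrite kill_varsX.
Qed.

End MonomialPrimes.
Arguments var_prime K {n} W.
Arguments var_primeP K {n} W.

(** * Primes of a quotient ring *)

Section QuotientPrimes.
Variables (R : comNzRingType) (I : idealr R).
Local Notation Q := {ideal_quot I}.

Lemma prime_chain_pullback k (P : nat -> {pred Q}) :
  prime_chain k P -> prime_chain k (fun i => [pred p | \pi_Q p \in P i]).
Proof.
case=> Pp Ps; split=> i leik.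
  have [[P0 P1 Plin] PM] := Pp i leik; split; first split.
  - by rewrite inE /= rmorph0.
  - by rewrite inE /= rmorph1.
  - by move=> a u v; rewrite !inE /= rmorphD rmorphM; apply: Plin.
  by move=> u v; rewrite !inE /= rmorphM; apply: PM.
have [sP [a Pa nPa]] := Ps i leik; split=> [p|].
  by rewrite !inE; apply: sP.
by exists (repr a); rewrite inE /= reprK.
Qed.

Lemma quot_eq0 p : p \in I -> \pi_Q p = 0.
Proof. by move=> Ip; apply/eqP; rewrite piE Quotient.equivE subr0. Qed.

(** Membership in a prime containing I does not depend on the representative, so
    such a prime has an image in the quotient. *)
Lemma repr_in (P : {pred R}) p :
  prime_ideal P -> {subset I <= P} -> (repr (\pi_Q p) \in P) = (p \in P).
Proof.
move=> primeP sIP; have Pd : repr (\pi_Q p) - p \in P.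
  by apply: sIP; rewrite Quotient.idealrBE reprK.
apply/idP/idP => Pp.
  by rewrite -(subKr (repr (\pi_Q p)) p) prime_idealB.
by rewrite -[repr _](subrK p) prime_idealD.
Qed.

Lemma prime_chain_push k (P : nat -> {pred R}) :
    prime_chain k P -> (forall i, (i <= k)%N -> {subset I <= P i}) ->
  prime_chain k (fun i => [pred a : Q | repr a \in P i]).
Proof.
move=> chP sIP; have Pp i leik := chP.1 i leik.
have inP i p : (i <= k)%N -> (repr (\pi_Q p) \in P i) = (p \in P i).
  by move=> leik; apply: repr_in; [apply: Pp | apply: sIP].
split=> i leik.
  have [[P0 P1 Plin] PM] := Pp i leik; split; first split.
  - by rewrite inE /= -(rmorph0 \pi_Q) inP.
  - by rewrite inE /= -(rmorph1 \pi_Q) inP.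
  - move=> a u v; rewrite !inE /= -[a]reprK -[u]reprK -[v]reprK.
    by rewrite -rmorphM -rmorphD !inP //; apply: Plin.
  move=> u v; rewrite !inE /= -[u]reprK -[v]reprK.
  by rewrite -rmorphM !inP //; apply: PM.
have [sP [a Pa nPa]] := chP.2 i leik; split=> [p|].
  by rewrite !inE; apply: sP.
by exists (\pi_Q a); rewrite inE /= inP // ltnW.
Qed.

End QuotientPrimes.

(** * The Krull dimension of an edge ring *)

Section EdgeRingDim.
Variables (K : fieldType) (G : sgraph).
Implicit Types A B : {set G}.

Definition independent A := [forall u in A, forall v in A, ~~ adj u v].

(** Isolated vertices are excluded because their variables belong to the edge
    ideal. *)
Definition face A := independent A && [disjoint A & isolated G].

Lemma independentP A :
  reflect {in A &, forall u v, ~~ adj u v} (independent A).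
Proof.
apply: (iffP forall_inP) => [h u v Au Av|h u Au].
  exact: (forall_inP (h u Au)).
by apply/forall_inP => v; apply: h.
Qed.

Lemma edge_ideal_gen p : edge_gen p -> p \in @edge_ideal K G.
Proof.
move=> gp; apply/ideal_genP; exists [:: (1, p)]; rewrite big_seq1 mul1r.
by split=> // c; rewrite inE => /eqP ->.
Qed.

Lemma edge_ideal_sub (P : {pred {mpoly K[#|G|]}}) :
    prime_ideal P -> (forall p, edge_gen p -> p \in P) ->
  {subset @edge_ideal K G <= P}.
Proof.
move=> primeP gP p /ideal_genP[s [sg ->]].
by apply: prime_ideal_sum => // c /sg/gP; apply: prime_idealMl.
Qed.

(** A product of two adjacent variables lies in P, so one of the two does. *)
Lemma face_of_prime (P : {pred {mpoly K[#|G|]}}) :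
    prime_ideal P -> {subset @edge_ideal K G <= P} ->
  face [set v | vvar K v \notin P].
Proof.
move=> primeP sIP; apply/andP; split.
  apply/independentP => u v; rewrite !inE => Pu Pv; apply/negP => uv.
  have /(prime_idealM primeP) : vvar K u * vvar K v \in P.
    by apply/sIP/edge_ideal_gen; left; exists u, v.
  by rewrite (negPf Pu) (negPf Pv).
rewrite -setI_eq0; apply/eqP/setP => v; rewrite !inE.
apply/andP => -[/negP Pv iso]; apply: Pv.
by apply/sIP/edge_ideal_gen; right; exists v; rewrite ?inE.
Qed.

Lemma edge_ideal_sub_var_prime (W : {set 'I_#|G|}) :
    face [set v | enum_rank v \notin W] ->
  {subset @edge_ideal K G <= var_prime K W}.
Proof.
case/andP=> /independentP indW dW; apply: edge_ideal_sub.
  exact: var_primeP.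
move=> p [[u [v [uv ->]]]|[v iso ->]]; last first.
  by rewrite var_prime_X; move: (disjointFl dW iso); rewrite inE => /negbFE.
have primeW := var_primeP K W.
have [Wu|Wu] := boolP (enum_rank u \in W).
  by apply: prime_idealMr; rewrite ?var_prime_X.
have [Wv|Wv] := boolP (enum_rank v \in W).
  by apply: prime_idealMl; rewrite ?var_prime_X.
by have := indW u v; rewrite !inE uv => /(_ Wu Wv).
Qed.

Lemma faceS A B : A \subset B -> face B -> face A.
Proof.
move=> sAB /andP[/independentP indB dB]; apply/andP; split.
  by apply/independentP => u v /(subsetP sAB) ? /(subsetP sAB); apply: indB.
exact: disjointWl dB.
Qed.

Lemma face0 : face set0.
Proof.
rewrite /face -setI_eq0 set0I eqxx andbT.
by apply/independentP => u v; rewrite inE.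
Qed.

(** The i-th prime is generated by the variables outside A and by the first i
    variables of A. *)
Lemma face_prime_chain A : face A ->
  exists P, prime_chain (A := edge_ring K G) #|A| P.
Proof.
move=> faceA.
pose W i := [set j : 'I_#|G| |
  ~~ ((enum_val j \in A) && (enum_val j \notin take i (enum A)))].
have sW i : W i \subset W i.+1.
  apply/subsetP => j; rewrite !inE !negb_and !negbK => /orP[-> //|jA].
  apply/orP; right; move: jA.
  by rewrite -(take_takel (enum A) (leqnSn i)) => /mem_take.
suff chP : prime_chain #|A| (fun i => var_prime K (W i)).
  eexists; apply: (prime_chain_push chP) => i _.
  apply: edge_ideal_sub_var_prime.
  apply: faceS faceA; apply/subsetP => v.
  by rewrite !inE negbK enum_rankK => /andP[].
split=> i ltiA; first exact: var_primeP.
split; first exact/var_prime_sub.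
have /card_gt0P[x0 _] := vertex_gt0 G.
have ltie : (i < size (enum A))%N by rewrite -cardE.
pose v := nth x0 (enum A) i.
have Av : v \in A by rewrite -mem_enum mem_nth.
exists (vvar K v); rewrite var_prime_X !inE enum_rankK Av /= negbK.
  by rewrite (take_nth x0) // mem_rcons inE eqxx.
by rewrite in_take ?index_uniq ?ltnn ?enum_uniq ?mem_enum.
Qed.

Lemma krull_dim_edge_ring :
  krull_dim (edge_ring K G) = Some (\max_(A : {set G} | face A) #|A|).
Proof.
apply/krull_dimP; split.
  have face_gt0 : (0 < #|face|)%N by apply/card_gt0P; exists set0; apply: face0.
  have [A faceA ->] := eq_bigmax_cond (fun A => #|A|) face_gt0.
  exact: face_prime_chain.
move=> k P chP; have chP' := prime_chain_pullback chP.
apply: leq_trans (prime_chain_mpoly_le chP') _.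
set S := [set i | _]; pose A := [set v : G | enum_rank v \in S].
have <- : #|A| = #|S|.
  rewrite -(card_imset S (@enum_val_inj _ _)); apply: eq_card => v.
  rewrite inE; apply/idP/imsetP => [Sv|[i Si ->]]; last by rewrite enum_valK.
  by exists (enum_rank v); rewrite ?enum_rankK.
apply: leq_bigmax_cond.
have -> : A =
    [set v | vvar K v \notin [pred p | \pi_(edge_ring K G) p \in P 0%N]].
  by apply/setP => v; rewrite !inE.
apply: face_of_prime; first exact: (chP'.1 0%N).
move=> p Ip; rewrite inE /= quot_eq0 //.
exact: (prime_ideal0 (chP.1 0%N isT)).
Qed.

End EdgeRingDim.

(** * Independent sets of a corona *)

Section IndependenceNumber.
Implicit Types G X H : sgraph.

Definition independence_number G : nat :=
  \max_(A : {set G} | independent A) #|A|.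

Lemma independence_numberP G :
  exists2 A : {set G}, independent A & #|A| = independence_number G.
Proof.
have ind_gt0 : (0 < #|@independent G|)%N.
  by apply/card_gt0P; exists set0; have /andP[] := face0 G.
have [A indA maxA] := eq_bigmax_cond (fun A : {set G} => #|A|) ind_gt0.
by exists A; rewrite ?[independence_number G]maxA.
Qed.

Lemma leq_independence_number G (A : {set G}) :
  independent A -> (#|A| <= independence_number G)%N.
Proof. exact: leq_bigmax_cond. Qed.

Lemma independence_number_gt0 G : (0 < independence_number G)%N.
Proof.
have /card_gt0P[v _] := vertex_gt0 G; rewrite -(cards1 v).
apply: leq_independence_number; apply/independentP => u w.
by rewrite !inE => /eqP-> /eqP->; rewrite adj_irr.
Qed.

(** Isolated vertices can be added to or removed from an independent set at will,
    so a largest independent set is a largest face together with all of them. *)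
Lemma independence_number_face G :
  (independence_number G =
    (\max_(A : {set G} | face A) #|A|) + #|isolated G|)%N.
Proof.
apply/eqP; rewrite eqn_leq; apply/andP; split.
  apply/bigmax_leqP => A indA; rewrite -(cardsID (isolated G) A) addnC.
  apply: leq_add; last by rewrite subset_leq_card ?subsetIr.
  apply: leq_bigmax_cond; apply/andP; split; last first.
    by rewrite -setI_eq0 setDE -setIA [~: _ :&: _]setIC setICr setI0.
  apply/independentP => u v /setDP[Au _] /setDP[Av _].
  by move/independentP: indA; apply.
have face_gt0 : (0 < #|@face G|)%N by apply/card_gt0P; exists set0; apply: face0.
have [A /andP[indA dA] ->] := eq_bigmax_cond (fun A : {set G} => #|A|) face_gt0.
have /eqP <- : #|A :|: isolated G| == (#|A| + #|isolated G|)%N.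
  by rewrite (leq_card_setU A (isolated G)).2.
apply: leq_independence_number; apply/independentP => u v.
have iso w w' : w \in isolated G -> ~~ adj w w' by rewrite inE => /forallP; apply.
move=> /setUP[Au|/iso //] /setUP[Av|/iso]; last by rewrite adj_sym.
by move/independentP: indA; apply.
Qed.

Definition corona_base X H (b : corona X H) : X :=
  match b with inl x => x | inr p => p.1 end.

(** Either x itself is in B, and then no vertex of its copy of H is, or the fiber
    is an independent set of that copy.  In the first case the fiber has a single
    element, which is at most the independence number because H is nonempty. *)
Lemma independent_fiber X H (B : {set corona X H}) x :
  independent B ->
  (#|[set b in B | corona_base b == x]| <= independence_number H)%N.
Proof.
move/independentP => indB; set F := [set b in B | _].
have [Bx|Bx] := boolP (inl x \in B).
  apply: leq_trans (independence_number_gt0 H).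
  rewrite -(cards1 (inl x : corona X H)).
  apply/subset_leq_card/subsetP => -[y|[y h]];
    rewrite !inE /= => /andP[By /eqP yx].
    by rewrite yx.
  by have := indB _ _ Bx By; rewrite /= yx eqxx.
pose A := [set h : H | inr (x, h) \in B].
apply: (@leq_trans #|A|); last first.
  apply: leq_independence_number; apply/independentP => h k.
  by rewrite !inE => Bh Bk; have := indB _ _ Bh Bk; rewrite /= eqxx.
rewrite -(card_imset (mem A)
  (_ : injective (fun h : H => inr (x, h) : corona X H))).
  apply/subset_leq_card/subsetP => -[y|[y h]];
    rewrite !inE /= => /andP[By /eqP yx].
    by rewrite -yx By in Bx.
  by apply/imsetP; exists h; rewrite ?inE -?yx.
by move=> h k [].
Qed.

Lemma independence_number_corona X H :
  independence_number (corona X H) = (#|X| * independence_number H)%N.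
Proof.
apply/eqP; rewrite eqn_leq; apply/andP; split.
  apply/bigmax_leqP => B indB; rewrite -sum_nat_const -sum1_card.
  rewrite (partition_big (@corona_base X H) xpredT) //=.
  apply: leq_sum => x _; rewrite sum1dep_card.
  by apply: leq_trans (independent_fiber x indB); rewrite cardsE.
have [A /independentP indA <-] := independence_numberP H.
rewrite -cardsT -cardsX.
rewrite -(card_imset _ (@inr_inj X (X * H)%type)).
apply: leq_independence_number; apply/independentP => b b'.
move=> /imsetP[[x h]]; rewrite inE /= inE => Ah -> /imsetP[[y k]].
by rewrite inE /= inE => Ak ->; rewrite /= negb_and indA ?orbT.
Qed.

End IndependenceNumber.

Theorem theorem3p1 (K : fieldType) (X H : sgraph) :
  exists2 d : nat, krull_dim (edge_ring K H) = Some d &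
    krull_dim (edge_ring K (corona X H)) =
      Some (#|X| * (d + #|isolated H|))%N.
Proof.
exists (\max_(A : {set H} | face A) #|A|); first exact: krull_dim_edge_ring.
rewrite krull_dim_edge_ring -independence_number_face.
rewrite -independence_number_corona independence_number_face.
by rewrite isolated_corona cards0 addn0.
Qed.
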